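(* Let $S$ be a Damek--Ricci space in the half-space model, and let $x_0=(V_0,Z_0,t_0)\in\mathfrak v\oplus\mathfrak z\oplus\mathbb R$ be an arbitrary point with $t_0<0$. Denote by $B\subset\mathfrak v$ the open ball of radius $2\sqrt{-t_0}$ centered at $V_0$. The focal variety $\mathcal F_{x_0}$ can be parameterized by the map $\Upsilon\colon B\to\mathcal F_{x_0}$, $$\Upsilon(\bar V)=\left(\bar V,\ Z_0-\tfrac12[\bar V,V_0],\ -t_0-\tfrac14\|\bar V-V_0\|^2\right).$$ Then for $\bar V\in B$, the geodesic curves starting from $\Upsilon(\bar V)$ in a direction tangent to $\mathcal F_{x_0}$ at $\Upsilon(\bar V)$ stay on $\mathcal F_{x_0}$ if and only if $\bar V-V_0$ satisfies the $J^2$-condition.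
   Context: Damek--Ricci space: let $\mathfrak s=\mathfrak v\oplus\mathfrak z\oplus\mathfrak a$ be an orthogonal decomposition of a finite-dimensional Euclidean space $(\mathfrak s,\langle\,,\rangle)$ with $\mathfrak a=\mathbb RA$, $\|A\|=1$, $n=\dim\mathfrak v$, $m=\dim\mathfrak z$ (either may be $0$). Let $J$ be a representation on $\mathfrak v$ of the Clifford algebra $\mathrm{Cl}(\mathfrak z,q)$ of $q(Z)=-\langle Z,Z\rangle$ with $\|J_ZV\|=\|Z\|\|V\|$. The Lie bracket on $\mathfrak s$ is determined by $\langle[U,V],Z\rangle=\langle J_ZU,V\rangle$ with $[U,V]\in\mathfrak z$ for $U,V\in\mathfrak v$, $Z\in\mathfrak z$; $[\mathfrak v\oplus\mathfrak z,\mathfrak z]=0$; $[A,V]=\frac12V$ for $V\in\mathfrak v$; $[A,Z]=Z$ for $Z\in\mathfrak z$. The simply connected Lie group $S$ with Lie algebra $\mathfrak s$ and the left-invariant metric induced by $\langle\,,\rangle$ is the Damek--Ricci space. Half-space model: $S$ is identified with $\mathfrak v\oplus\mathfrak z\times\mathbb R_+\subset\mathfrak v\oplus\mathfrak z\oplus\mathbb R$ via $(V,Z,t)\mapsto\exp(V+Z)\exp((\ln t)A)$; multiplication is $(V_1,Z_1,t_1)(V_2,Z_2,t_2)=(V_1+\sqrt{t_1}V_2,\ Z_1+t_1Z_2+\frac12\sqrt{t_1}[V_1,V_2],\ t_1t_2)$. The unit speed geodesic from $e=(0,0,1)$ with unit initial velocity $v+z+sA$ is $\hat\gamma(t)=\gamma(\tanh(t/2))$,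 $\gamma(\theta)=\left(\frac{2\theta(1-s\theta)}{\chi(\theta)}v+\frac{2\theta^2}{\chi(\theta)}J_zv,\frac{2\theta}{\chi(\theta)}z,\frac{1-\theta^2}{\chi(\theta)}\right)$, $\chi(\theta)=(1-s\theta)^2+\|z\|^2\theta^2$. Focal varieties $\mathcal F_{x_0}$: for $x_0=(V_0,Z_0,t_0)$ let $D_{x_0}((V,Z,t))=\frac1t\left(\left(t+t_0+\left\|\frac{V-V_0}{2}\right\|^2\right)^2+\left\|Z-Z_0+\frac12[V,V_0]\right\|^2\right)$ on $S$. For $t_0<0$ the minimum of $D_{x_0}$ is $0$, and $\mathcal F_{x_0}=D_{x_0}^{-1}(0)=\{(V,Z,t)\in S:\|V-V_0\|^2=-4(t+t_0),\ Z=Z_0-\frac12[V,V_0]\}$. $J^2$-condition: $v\in\mathfrak v$ satisfies the $J^2$-condition if for any $z_1,z_2\in\mathfrak z$ with $z_1\perp z_2$ there exists $z_3\in\mathfrak z$ with $J_{z_1}J_{z_2}v=J_{z_3}v$. *)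

(* Defs.v *)
From HB Require Import structures.
From mathcomp Require Import all_boot all_order all_algebra.
From mathcomp Require Import all_classical all_reals all_analysis.

Set Implicit Arguments.
Unset Strict Implicit.
Unset Printing Implicit Defensive.

Import Order.TTheory GRing.Theory Num.Theory.
Import numFieldNormedType.Exports.

Local Open Scope classical_set_scope.
Local Open Scope ring_scope.

(* v and z are R^n and R^m with the standard inner product, i.e. written in
   orthonormal bases. *)
Definition dot (R : realType) (k : nat) (u w : 'rV[R]_k) : R :=
  \sum_(i < k) u 0 i * w 0 i.

(* The norm `|u| of the library on row vectors is the sup norm. *)
Definition enorm (R : realType) (k : nat) (u : 'rV[R]_k) : R :=
  Num.sqrt (dot u u).

(* By the universal property of Cl(z, q), q(Z) = - <Z, Z>, a representation of
   it on v is a linear map J from z to End(v) such that J_Z^2 = q(Z) id. *)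
Definition orthogonal_clifford_rep (R : realType) (n m : nat)
    (J : {linear 'rV[R]_m -> 'End('rV[R]_n)}) : Prop :=
  (forall Z V, J Z (J Z V) = - dot Z Z *: V) /\
  (forall Z V, enorm (J Z V) = enorm Z * enorm V).

(* The element [U, V] of z determined by <[U, V], Z> = <J_Z U, V>; its
   coordinates are obtained by taking for Z the vectors of the standard basis. *)
Definition vbracket (R : realType) (n m : nat)
    (J : {linear 'rV[R]_m -> 'End('rV[R]_n)}) (U V : 'rV[R]_n) : 'rV[R]_m :=
  \row_(k < m) dot (J (delta_mx 0 k) U) V.

(* v * z * R is used both for the Lie algebra s, where (V, Z, a) stands for
   V + Z + a A, and for the ambient space of the half-space model of S. *)
Notation dr_space R n m := ('rV[R]_n * 'rV[R]_m * R)%type.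

Definition inner (R : realType) (n m : nat) (X Y : dr_space R n m) : R :=
  dot X.1.1 Y.1.1 + dot X.1.2 Y.1.2 + X.2 * Y.2.

Definition lie_bracket (R : realType) (n m : nat)
    (J : {linear 'rV[R]_m -> 'End('rV[R]_n)}) (X Y : dr_space R n m) :
    dr_space R n m :=
  ((X.2 / 2) *: Y.1.1 - (Y.2 / 2) *: X.1.1,
   vbracket J X.1.1 Y.1.1 + X.2 *: Y.1.2 - Y.2 *: X.1.2,
   0).

Definition half_space (R : realType) (n m : nat) : set (dr_space R n m) :=
  [set p | 0 < p.2].

Definition dr_unit (R : realType) (n m : nat) : dr_space R n m := (0, 0, 1).

Definition dr_mul (R : realType) (n m : nat)
    (J : {linear 'rV[R]_m -> 'End('rV[R]_n)}) (p q : dr_space R n m) :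
    dr_space R n m :=
  (p.1.1 + Num.sqrt p.2 *: q.1.1,
   p.1.2 + p.2 *: q.1.2 + (2^-1 * Num.sqrt p.2) *: vbracket J p.1.1 q.1.1,
   p.2 * q.2).

(* The value at p of the left-invariant vector field of S defined by X in s. *)
Definition left_field (R : realType) (n m : nat)
    (J : {linear 'rV[R]_m -> 'End('rV[R]_n)}) (X p : dr_space R n m) :
    dr_space R n m :=
  'D_X (dr_mul J p) (dr_unit R n m).

(* <nabla_X Y, W> for left-invariant fields X, Y, W and the Levi-Civita
   connection nabla of the left-invariant metric: Koszul's formula, in which
   the derivatives of the (constant) inner products vanish. *)
Definition levi_civita (R : realType) (n m : nat)
    (J : {linear 'rV[R]_m -> 'End('rV[R]_n)}) (X Y W : dr_space R n m) : R :=
  (inner (lie_bracket J X Y) W - inner (lie_bracket J X W) Y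
   - inner (lie_bracket J Y W) X) / 2.

(* omega expresses the velocity of c in the left-invariant frame.  In that frame
   the covariant derivative of the velocity along c is
   omega' + nabla_omega omega; c is a geodesic when it vanishes.  Geodesics are
   parameterized proportionally to arc length and, S being complete, by R. *)
Definition geodesic (R : realType) (n m : nat)
    (J : {linear 'rV[R]_m -> 'End('rV[R]_n)}) (c : R -> dr_space R n m) : Prop :=
  (forall x, half_space (c x)) /\
  exists omega : R -> dr_space R n m, forall x : R,
    [/\ is_derive x 1 c (left_field J (omega x) (c x)),
        derivable omega x 1
      & forall W : dr_space R n m,
          inner (derive1 omega x) W + levi_civita J (omega x) (omega x) W = 0].

(* D_{x0}, for x0 = (V0, Z0, t0). *)
Definition focal_dist (R : realType) (n m : nat)
    (J : {linear 'rV[R]_m -> 'End('rV[R]_n)}) (x0 p : dr_space R n m) : R :=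
  p.2^-1 *
  ((p.2 + x0.2 + enorm (2^-1 *: (p.1.1 - x0.1.1)) ^+ 2) ^+ 2
   + enorm (p.1.2 - x0.1.2 + 2^-1 *: vbracket J p.1.1 x0.1.1) ^+ 2).

Definition focal_variety (R : realType) (n m : nat)
    (J : {linear 'rV[R]_m -> 'End('rV[R]_n)}) (x0 : dr_space R n m) :
    set (dr_space R n m) :=
  [set p | half_space p /\ focal_dist J x0 p = 0].

Definition open_ball (R : realType) (k : nat) (V0 : 'rV[R]_k) (r : R) :
    set 'rV[R]_k :=
  [set V | enorm (V - V0) < r].

Definition Upsilon (R : realType) (n m : nat)
    (J : {linear 'rV[R]_m -> 'End('rV[R]_n)}) (x0 : dr_space R n m)
    (V : 'rV[R]_n) : dr_space R n m :=
  (V,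
   x0.1.2 - 2^-1 *: vbracket J V x0.1.1,
   - x0.2 - 4^-1 * enorm (V - x0.1.1) ^+ 2).

(* The velocities at p of the curves that pass through p and lie in F. *)
Definition tangent_vector (R : realType) (n m : nat) (F : set (dr_space R n m))
    (p w : dr_space R n m) : Prop :=
  exists c : R -> dr_space R n m,
    [/\ c 0 = p, is_derive (0 : R) 1 c w & \forall x \near (0 : R), F (c x)].

Definition J2_condition (R : realType) (n m : nat)
    (J : {linear 'rV[R]_m -> 'End('rV[R]_n)}) (v : 'rV[R]_n) : Prop :=
  forall z1 z2 : 'rV[R]_m, dot z1 z2 = 0 ->
    exists z3 : 'rV[R]_m, J z1 (J z2 v) = J z3 v.

(* Main.v *)
From HB Require Import structures.
Require Import Defs.
From mathcomp Require Import all_boot all_order all_algebra.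
From mathcomp Require Import all_classical all_reals all_analysis.
From mathcomp Require Import ring lra.
Import Order.TTheory GRing.Theory Num.Theory.
Import numFieldNormedType.Exports.

Set Implicit Arguments.
Unset Strict Implicit.
Unset Printing Implicit Defensive.

Local Open Scope classical_set_scope.
Local Open Scope ring_scope.

(** Along a geodesic c = (V, Z, t) write the velocity in the left-invariant
    frame as (v, z, s) and put U = V - V0 and r = t^(-1/2).  The geodesic
    equation is v' = s v / 2 + J_z v, z' = s z, s' = - (|v|^2 / 2 + |z|^2), and
    the position satisfies V' = sqrt t v, Z' = t z + sqrt t [V, v] / 2, t' = t s.

    The curve lies on the focal variety when f = |U|^2 + 4 (t + t0) and
    g = Z - Z0 + [V, V0] / 2 both vanish.  These quantities satisfy a closed
    system: with h = r <U, v> + 2 s, k = z + r [U, v] / 2 and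
    l = s z + r [U, J_z v] / 2,
      f' = 2 t h,  h' = - 2 <k, z>,  g' = t k,  k' = l,  l' = s l - |z|^2 k.
    Hence, for every fixed component, (|z|^2 k^2 + l^2) / t^2 is constant.  The
    velocity is tangent to the focal variety at time 0 exactly when h and k
    vanish there, so a geodesic that starts on the variety and is tangent to it
    stays on it if and only if l = 0 at time 0: if l = 0 then the conserved
    quantity vanishes, which kills l, k, g, h and f in turn, and conversely
    g = 0 forces k = 0 and then l = 0.

    It remains to see that l = 0 for all tangent velocities is the J^2-condition
    on w = V - V0 (at time 0).  One direction is [J2_second_derivative]: the
    component of l along z vanishes because h does, and for Z orthogonal to z the
    condition turns <J_Z w, J_z v> = - <J_z J_Z w, v> into - <J_Z3 w, v>, a
    multiple of <z, Z3> = 0.  For the other direction, given z1 orthogonal to z2,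
    let y be the component of x = J_z1 J_z2 w orthogonal to all J_Z w.  The
    velocity with v = J_z1 w + y has z proportional to z1, and l = 0 gives
    <x, y> = 0, that is y = 0 ([J2_of_orthogonal]).  Here <w, v> = 0, so tangency
    means s = 0, and only the geodesics with s = 0 at time 0 have to be known to
    exist for all times; they are written down in closed form
    ([exists_geodesic]). *)

(** * Euclidean inner product *)

Section Dot.
Variables (R : realType) (k : nat).
Implicit Types u v w : 'rV[R]_k.

Lemma dotC u v : dot u v = dot v u.
Proof. by rewrite /dot; apply: eq_bigr => i _; rewrite mulrC. Qed.

Lemma dot_bilinear : bilinear_for *%R *%R (@dot R k).
Proof.
split=> [v|u] a x y /=; rewrite /dot mulr_sumr -big_split /=;
  by apply: eq_bigr => i _; rewrite !mxE; ring.
Qed.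

HB.instance Definition _ :=
  bilinear_isBilinear.Build R _ _ R *%R *%R (@dot R k) dot_bilinear.

Lemma dotDl u v w : dot (u + v) w = dot u w + dot v w.
Proof. exact: linearDl. Qed.

Lemma dotDr u v w : dot w (u + v) = dot w u + dot w v.
Proof. exact: linearDr. Qed.

Lemma dotBl u v w : dot (u - v) w = dot u w - dot v w.
Proof. exact: linearBl. Qed.

Lemma dotBr u v w : dot w (u - v) = dot w u - dot w v.
Proof. exact: linearBr. Qed.

Lemma dotNl u v : dot (- u) v = - dot u v.
Proof. exact: linearNl. Qed.

Lemma dotNr u v : dot u (- v) = - dot u v.
Proof. exact: linearNr. Qed.

Lemma dotZl a u v : dot (a *: u) v = a * dot u v.
Proof. exact: linearZl_LR. Qed.

Lemma dotZr a u v : dot u (a *: v) = a * dot u v.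
Proof. by rewrite dotC dotZl dotC. Qed.

Lemma dot0l u : dot 0 u = 0.
Proof. exact: linear0l. Qed.

Lemma dot0r u : dot u 0 = 0.
Proof. exact: linear0r. Qed.

Definition dotE := (dotDl, dotDr, dotBl, dotBr, dotNl, dotNr, dotZl, dotZr,
  dot0l, dot0r).

Lemma dot_delta u i : dot u (delta_mx 0 i) = u 0 i.
Proof.
rewrite /dot (bigD1 i) //= mxE !eqxx mulr1 big1 ?addr0 // => j ij.
by rewrite mxE (negbTE ij) andbF mulr0.
Qed.

Lemma dot_ext u v : (forall w, dot u w = dot v w) -> u = v.
Proof. by move=> uv; apply/rowP => i; rewrite -!dot_delta. Qed.

Lemma dot_ge0 u : 0 <= dot u u.
Proof. by rewrite sumr_ge0 // => i _; rewrite -expr2 sqr_ge0. Qed.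

Lemma dot_eq0 u : (dot u u == 0) = (u == 0).
Proof.
apply/eqP/eqP => [u0|->]; last by rewrite dot0l.
apply/rowP => i; rewrite mxE; apply/eqP; rewrite -sqrf_eq0 expr2; apply/eqP.
by apply: (psumr_eq0P _ u0) => // j _; rewrite -expr2 sqr_ge0.
Qed.

Lemma enorm_sqr u : enorm u ^+ 2 = dot u u.
Proof. by rewrite sqr_sqrtr // dot_ge0. Qed.

Lemma enorm_ge0 u : 0 <= enorm u.
Proof. exact: sqrtr_ge0. Qed.

End Dot.

(** * Clifford multiplication and the bracket *)

Section Clifford.
Variables (R : realType) (n m : nat) (J : {linear 'rV[R]_m -> 'End('rV[R]_n)}).
Implicit Types (u v : 'rV[R]_n) (z : 'rV[R]_m).

Lemma clifDl z1 z2 v : J (z1 + z2) v = J z1 v + J z2 v.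
Proof. by rewrite linearD add_lfunE. Qed.

Lemma clifZl a z v : J (a *: z) v = a *: J z v.
Proof. by rewrite linearZ scale_lfunE. Qed.

Lemma clif0l v : J 0 v = 0.
Proof. by rewrite linear0 zero_lfunE. Qed.

Lemma dot_vbracket u v z : dot (vbracket J u v) z = dot (J z u) v.
Proof.
rewrite {2}(row_sum_delta z) linear_sum sum_lfunE linear_sumlz /=.
by rewrite [LHS]/dot; apply: eq_bigr => i _; rewrite mxE clifZl dotZl mulrC.
Qed.

Lemma vbracket_bilinear : bilinear_for *:%R *:%R (vbracket J).
Proof.
split=> [v|u] a x y; apply: dot_ext => z; rewrite !dotE !dot_vbracket.
  by rewrite linearP !dotE.
by rewrite !dotE.
Qed.

HB.instance Definition _ :=
  bilinear_isBilinear.Build R _ _ _ *:%R *:%R (vbracket J) vbracket_bilinear.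

Hypothesis hJ : orthogonal_clifford_rep J.

Lemma clif_sqr z v : J z (J z v) = - dot z z *: v.
Proof. exact: hJ.1. Qed.

Lemma dot_clif z v : dot (J z v) (J z v) = dot z z * dot v v.
Proof. by rewrite -!enorm_sqr hJ.2 exprMn. Qed.

(** Polarization of the norm identity in the vector argument. *)
Lemma dot_clif_vec z u v : dot (J z u) (J z v) = dot z z * dot u v.
Proof.
have := dot_clif z (u + v); rewrite linearD !dotE !dot_clif.
by rewrite (dotC (J z v)) (dotC v u) => H; lra.
Qed.

(** Polarization of the norm identity in the Clifford argument. *)
Lemma dot_clif_center z1 z2 v : dot (J z1 v) (J z2 v) = dot z1 z2 * dot v v.
Proof.
have := dot_clif (z1 + z2) v; rewrite clifDl !dotE !dot_clif.
by rewrite (dotC (J z2 v)) (dotC z2 z1) => H; lra.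
Qed.

(** J_z is skew because it is orthogonal up to the factor |z| and squares to
    - |z|^2. *)
Lemma clif_skew z u v : dot (J z u) v = - dot u (J z v).
Proof.
have [->|z0] := eqVneq z 0; first by rewrite !clif0l !dotE oppr0.
have zz : dot z z != 0 by rewrite dot_eq0.
apply: (mulfI zz).
by rewrite -dot_clif_vec clif_sqr dotZl mulNr mulrN.
Qed.

Lemma dot_clif_self z v : dot (J z v) v = 0.
Proof. by have := clif_skew z v v; rewrite (dotC v) => H; lra. Qed.

Lemma vbracket_self u : vbracket J u u = 0.
Proof. by apply: dot_ext => z; rewrite dot_vbracket dot_clif_self dot0l. Qed.

End Clifford.

(** * Derivatives of bilinear expressions *)

Section Calculus.
Variable R : realType.

(** In finite dimension a bilinear map is a polynomial in the coordinates. *)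
Lemma continuous_rV_bilinear (p q : nat) (W : normedModType R)
    (B : {bilinear 'rV[R]_p -> 'rV[R]_q -> W}) :
  continuous (fun u : 'rV[R]_p * 'rV[R]_q => B u.1 u.2).
Proof.
move=> u.
have -> : (fun u : 'rV[R]_p * 'rV[R]_q => B u.1 u.2) =
    (fun u => \sum_i \sum_j
        (u.1 0 i * u.2 0 j) *: B (delta_mx 0 i) (delta_mx 0 j)).
  apply/funext => x; rewrite {1}(row_sum_delta x.1) linear_sumlz /=.
  apply: eq_bigr => i _; rewrite linearZl_LR /= {1}(row_sum_delta x.2).
  rewrite linear_sumr /= scaler_sumr.
  by apply: eq_bigr => j _; rewrite linearZr_LR scalerA.
apply: cvg_big; [exact: add_continuous|move=> i _].
apply: cvg_big; [exact: add_continuous|move=> j _].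
apply: cvgZr_tmp; apply: cvgM.
  apply: (@continuous_comp _ _ _ fst (fun v : 'rV[R]_p => v 0 i)).
    exact: cvg_fst.
  exact: coord_continuous.
apply: (@continuous_comp _ _ _ snd (fun v : 'rV[R]_q => v 0 j)).
  exact: cvg_snd.
exact: coord_continuous.
Qed.

Lemma is_diff_bilinear (U V1 V2 W : normedModType R)
    (B : {bilinear V1 -> V2 -> W}) (f df : U -> V1) (g dg : U -> V2) (x : U) :
  continuous (fun u => B u.1 u.2) -> is_diff x f df -> is_diff x g dg ->
  is_diff x (fun y => B (f y) (g y)) (fun h => B (f x) (dg h) + B (df h) (g x)).
Proof.
move=> Bc hf hg.
have hB : is_diff (f x, g x) (fun u => B u.1 u.2)
    (fun u => B (f x) u.2 + B u.1 (g x)).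
  apply: DiffDef; last by rewrite diff_bilin.
  exact: (differentiable_bilin _ Bc).
exact: (@is_diff_comp _ _ _ _ (fun y => (f y, g y)) (fun h => (df h, dg h))
  (fun u => B u.1 u.2) _ x _ hB).
Qed.

(** Along a curve the derivative and the differential carry the same data; the
    differential is the form that composes with maps of several variables. *)
Lemma is_derive_diff (W : normedModType R) (f : R -> W) (x : R) df :
  is_derive x 1 f df <-> is_diff x f ( *:%R ^~ df).
Proof.
split=> [[dfx <-]|[dfx dfE]].
  have dfx' : differentiable f x by apply/derivable1_diffP.
  apply: DiffDef => //; rewrite diff1E //.
  by rewrite derive1E.
apply: DeriveDef; first exact/derivable1_diffP.
by rewrite deriveE // dfE scale1r.
Qed.

Lemma is_derive_bilinear (V1 V2 W : normedModType R)
    (B : {bilinear V1 -> V2 -> W}) (f : R -> V1) (g : R -> V2) df dg (x : R) :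
  continuous (fun u => B u.1 u.2) ->
  is_derive x 1 f df -> is_derive x 1 g dg ->
  is_derive x 1 (fun y => B (f y) (g y)) (B (f x) dg + B df (g x)).
Proof.
move=> Bc /is_derive_diff hf /is_derive_diff hg; apply/is_derive_diff.
apply: is_diff_eq (is_diff_bilinear Bc hf hg) _.
by apply/funext => h; rewrite linearZr_LR linearZl_LR scalerDr.
Qed.

Lemma is_derive_rV_bilinear (W : normedModType R) (p q : nat)
    (B : {bilinear 'rV[R]_p -> 'rV[R]_q -> W})
    (f : R -> 'rV[R]_p) (g : R -> 'rV[R]_q) df dg (x : R) :
  is_derive x 1 f df -> is_derive x 1 g dg ->
  is_derive x 1 (fun y => B (f y) (g y)) (B (f x) dg + B df (g x)).
Proof. exact: (is_derive_bilinear (@continuous_rV_bilinear _ _ _ B)). Qed.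

Lemma is_derive_dot (k : nat) (f g : R -> 'rV[R]_k) df dg (x : R) :
  is_derive x 1 f df -> is_derive x 1 g dg ->
  is_derive x 1 (fun y => dot (f y) (g y)) (dot (f x) dg + dot df (g x)).
Proof. exact: (@is_derive_rV_bilinear R _ _ (@dot R k)). Qed.

Lemma is_derive_vbracket (n m : nat) (J : {linear 'rV[R]_m -> 'End('rV[R]_n)})
    (f g : R -> 'rV[R]_n) df dg (x : R) :
  is_derive x 1 f df -> is_derive x 1 g dg ->
  is_derive x 1 (fun y => vbracket J (f y) (g y))
    (vbracket J (f x) dg + vbracket J df (g x)).
Proof. exact: (@is_derive_rV_bilinear _ _ _ (vbracket J)). Qed.

Lemma clif_bilinear (n m : nat) (J : {linear 'rV[R]_m -> 'End('rV[R]_n)}) :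
  bilinear_for *:%R *:%R (fun z => J z : 'rV[R]_n -> 'rV[R]_n).
Proof.
split=> [v|z] a x y /=; last by rewrite linearP.
by rewrite clifDl clifZl.
Qed.

Lemma is_derive_clif (n m : nat) (J : {linear 'rV[R]_m -> 'End('rV[R]_n)})
    (z : R -> 'rV[R]_m) (v : R -> 'rV[R]_n) dz dv (x : R) :
  is_derive x 1 z dz -> is_derive x 1 v dv ->
  is_derive x 1 (fun y => J (z y) (v y)) (J (z x) dv + J dz (v x)).
Proof.
pose JM := bilinear_isBilinear.Build R _ _ _ *:%R *:%R
  (fun z => J z : 'rV[R]_n -> 'rV[R]_n) (clif_bilinear J).
pose JB : {bilinear 'rV[R]_m -> 'rV[R]_n -> 'rV[R]_n} :=
  HB.pack (fun z => J z : 'rV[R]_n -> 'rV[R]_n) JM.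
exact: (@is_derive_rV_bilinear _ _ _ JB).
Qed.

Lemma is_derive_scale (W : normedModType R) (a : R -> R) (f : R -> W) da df
    (x : R) :
  is_derive x 1 a da -> is_derive x 1 f df ->
  is_derive x 1 (fun y => a y *: f y) (a x *: df + da *: f x).
Proof.
have sB : bilinear_for *:%R *:%R ( *:%R : R -> W -> W).
  split=> [v|b] c y z /=; first by rewrite scalerDl scalerA.
  by rewrite scalerDr !scalerA mulrC.
pose sM := bilinear_isBilinear.Build R _ _ _ *:%R *:%R
  ( *:%R : R -> W -> W) sB.
pose S : {bilinear R -> W -> W} := HB.pack ( *:%R : R -> W -> W) sM.
by apply: (@is_derive_bilinear _ _ _ S) => u; exact: scale_continuous.
Qed.

Lemma is_derive_pair (V W : normedModType R) (f : R -> V) (g : R -> W) df dg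
    (x : R) :
  is_derive x 1 f df -> is_derive x 1 g dg ->
  is_derive x 1 (fun y => (f y, g y)) (df, dg).
Proof.
move=> /is_derive_diff hf /is_derive_diff hg; exact/is_derive_diff.
Qed.

Lemma is_diff_fst (V W : normedModType R) (p : V * W) : is_diff p fst fst.
Proof.
have c : continuous (fst : V * W -> V) by move=> ?; exact: cvg_fst.
by apply: DiffDef; [exact: linear_differentiable|rewrite diff_lin].
Qed.

Lemma is_diff_snd (V W : normedModType R) (p : V * W) : is_diff p snd snd.
Proof.
have c : continuous (snd : V * W -> W) by move=> ?; exact: cvg_snd.
by apply: DiffDef; [exact: linear_differentiable|rewrite diff_lin].
Qed.

Lemma is_derive_fst (V W : normedModType R) (f : R -> V * W) df (x : R) :
  is_derive x 1 f df -> is_derive x 1 (fun y => (f y).1) df.1.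
Proof.
move=> /is_derive_diff hf; apply/is_derive_diff.
exact: (is_diff_comp hf (is_diff_fst (f x))).
Qed.

Lemma is_derive_snd (V W : normedModType R) (f : R -> V * W) df (x : R) :
  is_derive x 1 f df -> is_derive x 1 (fun y => (f y).2) df.2.
Proof.
move=> /is_derive_diff hf; apply/is_derive_diff.
exact: (is_diff_comp hf (is_diff_snd (f x))).
Qed.

End Calculus.

Section RealCalculus.
Variables (R : realType).
Implicit Types (f g : R -> R) (x : R).

(** The rules below are stated for pointwise expressions, the shape in which
    coordinates of a curve appear, so that they compose by plain application. *)
Lemma is_derive_const (a x : R) : is_derive x 1 (fun=> a) 0.
Proof. exact: is_derive_cst. Qed.

Lemma is_derive_add f g df dg x : is_derive x 1 f df -> is_derive x 1 g dg ->
  is_derive x 1 (fun y => f y + g y) (df + dg).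
Proof. by move=> hf hg; exact: is_deriveD. Qed.

Lemma is_derive_mul f g df dg x : is_derive x 1 f df -> is_derive x 1 g dg ->
  is_derive x 1 (fun y => f y * g y) (df * g x + f x * dg).
Proof.
move=> hf hg; apply: is_derive_eq (is_deriveM hf hg) _.
by rewrite addrC [_ *: df]mulrC.
Qed.

Lemma is_derive_inv f df x : f x != 0 -> is_derive x 1 f df ->
  is_derive x 1 (fun y => (f y)^-1) (- df / (f x) ^+ 2).
Proof.
move=> fx0 hf; apply: is_derive_eq (is_deriveV fx0 hf) _.
by rewrite -[LHS]/(_ * _) mulrC mulNr mulrN.
Qed.

Lemma is_derive_sqrt f df x : 0 < f x -> is_derive x 1 f df ->
  is_derive x 1 (fun y => Num.sqrt (f y)) (df / (2 * Num.sqrt (f x))).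
Proof.
move=> fx0 hf; apply: is_derive_eq (is_derive1_comp (is_derive1_sqrt fx0) hf) _.
by rewrite mulrC.
Qed.

End RealCalculus.

(** * The geodesic equation *)

Section Geodesics.
Variables (R : realType) (n m : nat) (J : {linear 'rV[R]_m -> 'End('rV[R]_n)}).
Implicit Types X Y W p : dr_space R n m.

Lemma derive_affine (V W : normedModType R) (f : V -> W) (x v : V) w :
  (forall h : R, f (h *: v + x) - f x = h *: w) -> 'D_v f x = w.
Proof.
move=> fE; rewrite /derive; apply: cvg_lim => //.
apply: cvg_near_cst; near=> h; rewrite /= fE scalerA mulVf ?scale1r //.
by near: h; exact: nbhs_dnbhs_neq.
Unshelve. all: by end_near. Qed.

(** Left multiplication by p is an affine map, so its derivative is its linear
    part. *)
Lemma left_fieldE X p : left_field J X p =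
  (Num.sqrt p.2 *: X.1.1,
   p.2 *: X.1.2 + (2^-1 * Num.sqrt p.2) *: vbracket J p.1.1 X.1.1, p.2 * X.2).
Proof.
apply: derive_affine => h; rewrite /dr_mul /dr_unit /=.
congr (_, _, _) => /=.
- by rewrite addr0 scaler0 addr0 addrC addKr !scalerA mulrC.
- rewrite !addr0 linear0r !scaler0 !addr0 linearZr_LR scalerDr !scalerA /=.
  rewrite -(addrA p.1.2) [LHS]addrC addKr; congr (_ *: _ + _ *: _).
    by rewrite mulrC.
  by rewrite mulrC mulrA.
- by rewrite -[RHS]/(h * _) mulr1 -[h *: X.2]/(h * X.2); ring.
Qed.

(** The value at X of minus the covariant derivative of X along itself, so that
    the velocity of a geodesic is an integral curve of this field. *)
Definition geodesic_field X : dr_space R n m :=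
  ((X.2 / 2) *: X.1.1 + J X.1.2 X.1.1, X.2 *: X.1.2,
   - (dot X.1.1 X.1.1 / 2 + dot X.1.2 X.1.2)).

Lemma inner_ext X Y : (forall W, inner X W = inner Y W) -> X = Y.
Proof.
move=> XY; case: X Y XY => [[v z] s] [[v' z'] s'] XY; congr (_, _, _).
- apply: dot_ext => w; have := XY (w, 0, 0).
  by rewrite /inner /= !dotE !mulr0 !addr0.
- apply: dot_ext => w; have := XY (0, w, 0).
  by rewrite /inner /= !dotE !mulr0 !addr0 !add0r.
- have := XY (0, 0, 1).
  by rewrite /inner /= !dotE !mulr1 !add0r.
Qed.

Hypothesis hJ : orthogonal_clifford_rep J.

(** The bracket of X with itself vanishes, so Koszul's formula reduces to
    - <[X, W], X>. *)
Lemma levi_civita_self X W :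
  levi_civita J X X W = - inner (geodesic_field X) W.
Proof.
rewrite /levi_civita /inner /lie_bracket /geodesic_field /=.
rewrite subrr (vbracket_self hJ) add0r subrr !dotE !dot_vbracket.
by rewrite (dotC W.1.1) (dotC W.1.2); field.
Qed.

Lemma geodesicP c : geodesic J c <->
  (forall x, 0 < (c x).2) /\ exists omega, forall x : R,
    is_derive x 1 c (left_field J (omega x) (c x)) /\
    is_derive x 1 omega (geodesic_field (omega x)).
Proof.
split=> -[ct [omega om]]; split=> //; exists omega => x.
  have [dc dom eq0] := om x; split=> //; apply: DeriveDef => //.
  apply: inner_ext => W; have := eq0 W.
  by rewrite levi_civita_self derive1E => /eqP; rewrite subr_eq0 => /eqP.
have [dc [dom domE]] := om x; split=> // W.
by rewrite levi_civita_self derive1E domE subrr.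
Qed.

End Geodesics.

(** * Evolution of the focal functions along a geodesic *)

Section FocalInvariants.
Variables (R : realType) (n m : nat) (J : {linear 'rV[R]_m -> 'End('rV[R]_n)}).
Hypothesis hJ : orthogonal_clifford_rep J.
Variables (c omega : R -> dr_space R n m).
Hypothesis c_gt0 : forall x, 0 < (c x).2.
Hypothesis dc : forall x : R, is_derive x 1 c (left_field J (omega x) (c x)).
Hypothesis domega : forall x : R,
  is_derive x 1 omega (geodesic_field J (omega x)).
Variable x0 : dr_space R n m.
Variable Z : 'rV[R]_m.

Local Notation V y := (c y).1.1.
Local Notation t y := (c y).2.
Local Notation v y := (omega y).1.1.
Local Notation z y := (omega y).1.2.
Local Notation s y := (omega y).2.
Local Notation U y := ((c y).1.1 - x0.1.1).
Local Notation r y := (Num.sqrt (c y).2)^-1.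

(** The functions f, h, g, k and l of the introduction, the last three paired with
    a fixed Z.  The primed functions h and k are the derivatives of f and g
    divided by 2 t and by t; these factors make the system linear in h, k, l. *)
Definition focal_height (y : R) : R := dot (U y) (U y) + 4 * (t y + x0.2).
Definition focal_height' (y : R) : R := r y * dot (U y) (v y) + 2 * s y.
Definition focal_center (y : R) : R :=
  dot ((c y).1.2 - x0.1.2 + 2^-1 *: vbracket J (V y) x0.1.1) Z.
Definition focal_center' (y : R) : R :=
  dot (z y) Z + 2^-1 * (r y * dot (J Z (U y)) (v y)).
Definition focal_center'' (y : R) : R :=
  s y * dot (z y) Z + 2^-1 * (r y * dot (J Z (U y)) (J (z y) (v y))).

Lemma sqrt_t_gt0 y : 0 < Num.sqrt (t y).
Proof. by rewrite sqrtr_gt0. Qed.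

Lemma sqrt_t_neq0 y : Num.sqrt (t y) != 0.
Proof. by rewrite gt_eqF // sqrt_t_gt0. Qed.

Lemma is_derive_t (x : R) : is_derive x 1 (fun y => t y) (t x * s x).
Proof. by have := is_derive_snd (dc x); rewrite left_fieldE. Qed.

Lemma is_derive_V (x : R) : is_derive x 1 (fun y => V y) (Num.sqrt (t x) *: v x).
Proof. by have := is_derive_fst (is_derive_fst (dc x)); rewrite left_fieldE. Qed.

Lemma is_derive_Z (x : R) : is_derive x 1 (fun y => (c y).1.2)
  (t x *: z x + (2^-1 * Num.sqrt (t x)) *: vbracket J (V x) (v x)).
Proof. by have := is_derive_snd (is_derive_fst (dc x)); rewrite left_fieldE. Qed.

Lemma is_derive_velV (x : R) : is_derive x 1 (fun y => v y)
  ((s x / 2) *: v x + J (z x) (v x)).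
Proof. exact: is_derive_fst (is_derive_fst (domega x)). Qed.

Lemma is_derive_z (x : R) : is_derive x 1 (fun y => z y) (s x *: z x).
Proof. exact: is_derive_snd (is_derive_fst (domega x)). Qed.

Lemma is_derive_s (x : R) : is_derive x 1 (fun y => s y)
  (- (dot (v x) (v x) / 2 + dot (z x) (z x))).
Proof. exact: is_derive_snd (domega x). Qed.

Lemma is_derive_U (x : R) : is_derive x 1 (fun y => U y) (Num.sqrt (t x) *: v x).
Proof.
apply: is_derive_eq (is_deriveB (is_derive_V x) (is_derive_cst _ _ _)) _.
by rewrite subr0.
Qed.

Lemma is_derive_r (x : R) : is_derive x 1 (fun y => r y) (- (s x / 2) * r x).
Proof.
have st := sqrt_t_gt0 x.
apply: is_derive_eq (is_derive_inv _
  (is_derive_sqrt (c_gt0 x) (is_derive_t x))) _.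
  by rewrite gt_eqF.
rewrite -{1}(sqr_sqrtr (ltW (c_gt0 x))); field.
by rewrite gt_eqF.
Qed.

Lemma is_derive_JU (x : R) :
  is_derive x 1 (fun y => J Z (U y)) (Num.sqrt (t x) *: J Z (v x)).
Proof.
apply: is_derive_eq (is_derive_clif J (is_derive_cst Z x 1) (is_derive_U x)) _.
by rewrite clif0l addr0 linearZ.
Qed.

Lemma rK x : r x * Num.sqrt (t x) = 1.
Proof. by rewrite mulVf // gt_eqF // sqrt_t_gt0. Qed.

Lemma sqrt_tE x : Num.sqrt (t x) = t x * r x.
Proof.
rewrite -[X in X * _](sqr_sqrtr (ltW (c_gt0 x))) expr2 mulfK //.
by rewrite gt_eqF // sqrt_t_gt0.
Qed.

Lemma is_derive_focal_height (x : R) :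
  is_derive x 1 focal_height (2 * t x * focal_height' x).
Proof.
apply: is_derive_eq (is_derive_add
  (is_derive_dot (is_derive_U x) (is_derive_U x))
  (is_derive_mul (is_derive_const 4 x)
    (is_derive_add (is_derive_t x) (is_derive_const x0.2 x)))) _.
rewrite !(dotZl, dotZr) /focal_height' (dotC (v x)).
by have := sqrt_tE x; set rx := r x => ->; rewrite /=; ring.
Qed.

(** The value is - 2 <k, z>; the terms in |v|^2 coming from U' and s' cancel. *)
Lemma is_derive_focal_height' (x : R) : is_derive x 1 focal_height'
  (- (2 * dot (z x) (z x) + r x * dot (J (z x) (U x)) (v x))).
Proof.
apply: is_derive_eq (is_derive_add
  (is_derive_mul (is_derive_r x)
    (is_derive_dot (is_derive_U x) (is_derive_velV x)))
  (is_derive_mul (is_derive_const 2 x) (is_derive_s x))) _.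
rewrite !(dotZl, dotZr) dotDr dotZr (clif_skew hJ).
have rr : r x * (t x * r x) = 1 by rewrite -sqrt_tE rK.
have := sqrt_tE x; set rx := r x => ->.
rewrite -/rx in rr.
transitivity ((rx * (t x * rx) - 1) * dot (v x) (v x)
  + (rx * dot (U x) (J (z x) (v x)) - 2 * dot (z x) (z x))); first by field.
by rewrite rr; ring.
Qed.

Lemma is_derive_focal_center (x : R) :
  is_derive x 1 focal_center (t x * focal_center' x).
Proof.
have dW : is_derive x 1
    (fun y => (c y).1.2 - x0.1.2 + 2^-1 *: vbracket J (V y) x0.1.1) _ :=
  is_deriveD (is_deriveB (is_derive_Z x) (is_derive_cst x0.1.2 x 1))
    (is_deriveZ 2^-1 (is_derive_vbracket J (is_derive_V x)
      (is_derive_cst x0.1.1 x 1))).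
apply: is_derive_eq (is_derive_dot dW (is_derive_cst Z x 1)) _.
rewrite /focal_center' linear0r !dotE !dot_vbracket linearZ linearB !dotE.
rewrite (clif_skew hJ Z (v x)) (dotC (v x)) /=.
have := sqrt_tE x; set rx := r x => ->.
by rewrite (clif_skew hJ Z (V x)) (clif_skew hJ Z x0.1.1); field.
Qed.

Lemma is_derive_focal_center' (x : R) :
  is_derive x 1 focal_center' (focal_center'' x).
Proof.
apply: is_derive_eq (is_derive_add
  (is_derive_dot (is_derive_z x) (is_derive_cst Z x 1))
  (is_derive_mul (is_derive_const 2^-1 x) (is_derive_mul (is_derive_r x)
    (is_derive_dot (is_derive_JU x) (is_derive_velV x))))) _.
have st := sqrt_t_neq0 x.
by rewrite /focal_center'' !dotE (dot_clif_self hJ); field.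
Qed.

(** The part of s' in |v|^2 cancels because [v, J_z v] = |v|^2 z. *)
Lemma is_derive_focal_center'' (x : R) : is_derive x 1 focal_center''
  (s x * focal_center'' x - dot (z x) (z x) * focal_center' x).
Proof.
apply: is_derive_eq (is_derive_add
  (is_derive_mul (is_derive_s x)
    (is_derive_dot (is_derive_z x) (is_derive_cst Z x 1)))
  (is_derive_mul (is_derive_const 2^-1 x) (is_derive_mul (is_derive_r x)
    (is_derive_dot (is_derive_JU x)
      (is_derive_clif J (is_derive_z x) (is_derive_velV x)))))) _.
have -> : J (z x) ((s x / 2) *: v x + J (z x) (v x)) =
    (s x / 2) *: J (z x) (v x) - dot (z x) (z x) *: v x.
  by rewrite linearD linearZ /= (clif_sqr hJ) scaleNr.
rewrite /cst clifZl !(dotDr, dotNr, dotZl, dotZr) dot0r.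
rewrite (dot_clif_center hJ) (dotC Z).
by have st := sqrt_t_neq0 x; rewrite /focal_center'' /focal_center'; field.
Qed.

Let r_gt0 y : 0 < r y.
Proof. by rewrite invr_gt0 sqrt_t_gt0. Qed.

(** The factor r^4 = t^(-2) compensates the common growth rate s of l and z. *)
Let energy y := (dot (z y) (z y) * (focal_center' y * focal_center' y)
  + focal_center'' y * focal_center'' y) * (r y * r y * (r y * r y)).

Lemma is_derive_energy (x : R) : is_derive x 1 energy 0.
Proof.
have dk := is_derive_focal_center' x; have dl := is_derive_focal_center'' x.
have dz := is_derive_z x; have dr := is_derive_r x.
have drr := is_derive_mul dr dr.
apply: is_derive_eq (is_derive_mul (is_derive_add
  (is_derive_mul (is_derive_dot dz dz) (is_derive_mul dk dk))
  (is_derive_mul dl dl)) (is_derive_mul drr drr)) _.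
by have st := sqrt_t_neq0 x; rewrite !(dotZl, dotZr); field.
Qed.

(** The conserved quantity is a sum of two squares with weights |z|^2 >= 0 and 1,
    so it controls l even where z vanishes; k then follows from k' = l. *)
Lemma focal_center''_eq0 x : focal_center' 0 = 0 -> focal_center'' 0 = 0 ->
  focal_center'' x = 0.
Proof.
move=> k0 l0; have := is_derive_0_is_cst x 0 is_derive_energy.
rewrite /energy k0 l0 !(mulr0, add0r, mul0r) => /eqP.
have rr : r x * r x * (r x * r x) != 0.
  by rewrite !mulf_neq0 // gt_eqF // r_gt0.
rewrite mulf_eq0 (negbTE rr) orbF paddr_eq0; last 2 first.
- by rewrite mulr_ge0 ?dot_ge0 // -expr2 sqr_ge0.
- by rewrite -expr2 sqr_ge0.
by case/andP => _; rewrite mulf_eq0 orbb => /eqP.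
Qed.

Lemma focal_center'_eq0 x : focal_center' 0 = 0 -> focal_center'' 0 = 0 ->
  focal_center' x = 0.
Proof.
move=> k0 l0; rewrite -k0; apply: is_derive_0_is_cst => y.
by have := is_derive_focal_center' y; rewrite focal_center''_eq0.
Qed.

Lemma focal_center_eq0 x : focal_center 0 = 0 -> focal_center' 0 = 0 ->
  focal_center'' 0 = 0 -> focal_center x = 0.
Proof.
move=> g0 k0 l0; rewrite -g0; apply: is_derive_0_is_cst => y.
by have := is_derive_focal_center y; rewrite focal_center'_eq0 // mulr0.
Qed.

(** The converse of [focal_center_eq0]: differentiate g = 0 twice. *)
Lemma focal_center''_0 : (forall x, focal_center x = 0) -> focal_center'' 0 = 0.
Proof.
move=> g0.
have k0 x : focal_center' x = 0.
  have dg : is_derive x 1 focal_center 0.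
    rewrite (_ : focal_center = fun=> 0); last exact/funext.
    exact: is_derive_const.
  have [_ dgE] := is_derive_focal_center x; case: dg => _; rewrite dgE => /eqP.
  by rewrite mulf_eq0 gt_eqF //= => /eqP.
have dk : is_derive (0 : R) 1 focal_center' 0.
  rewrite (_ : focal_center' = fun=> 0); last exact/funext.
  exact: is_derive_const.
have [_ dkE] := is_derive_focal_center' 0.
by case: dk => _; rewrite dkE.
Qed.

End FocalInvariants.

(** * The focal variety and its tangent vectors *)

Section FocalVariety.
Variables (R : realType) (n m : nat) (J : {linear 'rV[R]_m -> 'End('rV[R]_n)}).
Variable x0 : dr_space R n m.
Implicit Types (p w : dr_space R n m) (V : 'rV[R]_n).

Lemma focal_varietyP p :
  focal_variety J x0 p <-> 0 < p.2 /\ p = Upsilon J x0 p.1.1.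
Proof.
case: p => [[V Z] t]; rewrite /focal_variety /half_space /focal_dist /Upsilon /=.
split=> -[t0]; last first.
  case=> -> tE; split=> //.
  have -> : forall a b : 'rV[R]_m, a - b - a + b = 0.
    by move=> a b; rewrite addrAC subrK subrr.
  have -> : t + x0.2 + enorm (2^-1 *: (V - x0.1.1)) ^+ 2 = 0.
    by rewrite tE !enorm_sqr !(dotZl, dotZr); field.
  by rewrite enorm_sqr dot0l expr0n addr0 mulr0.
move=> /eqP; rewrite mulf_eq0 invr_eq0 gt_eqF //= paddr_eq0 ?sqr_ge0 //.
rewrite sqrf_eq0 !enorm_sqr dot_eq0 !(dotZl, dotZr) => /andP[/eqP hE /eqP gE].
split=> //; congr (_, _, _).
  by apply/eqP; rewrite -subr_eq0 opprB addrA addrAC -gE eqxx.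
by move: hE => /eqP; rewrite addr_eq0 => /eqP; lra.
Qed.

Lemma UpsilonP V : focal_variety J x0 (Upsilon J x0 V) <->
  0 < (Upsilon J x0 V).2.
Proof. by rewrite focal_varietyP; split=> [[]|]. Qed.

Lemma is_derive_Upsilon (f : R -> 'rV[R]_n) df (x : R) : is_derive x 1 f df ->
  is_derive x 1 (fun y => Upsilon J x0 (f y))
    (df, - (2^-1 *: vbracket J df x0.1.1), - (2^-1 * dot (f x - x0.1.1) df)).
Proof.
move=> hf; apply: is_derive_pair; first apply: is_derive_pair => //.
  apply: is_derive_eq (is_deriveB (is_derive_cst x0.1.2 x 1) (is_deriveZ 2^-1
    (is_derive_vbracket J hf (is_derive_cst x0.1.1 x 1)))) _.
  by rewrite linear0r !add0r.
have -> : (fun y => - x0.2 - 4^-1 * enorm (f y - x0.1.1) ^+ 2) =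
    (fun y => - x0.2 + - 4^-1 * dot (f y - x0.1.1) (f y - x0.1.1)).
  by apply/funext => y; rewrite enorm_sqr mulNr.
have hu : is_derive x 1 (fun y => f y - x0.1.1) df.
  apply: is_derive_eq (is_deriveB hf (is_derive_cst _ _ _)) _.
  by rewrite subr0.
apply: is_derive_eq (is_derive_add (is_derive_const (- x0.2) x)
  (is_derive_mul (is_derive_const (- 4^-1) x) (is_derive_dot hu hu))) _.
by rewrite (dotC df); field.
Qed.

(** A curve on the variety is the image under the parameterization of its first
    coordinate; conversely the image of a straight line realizes each solution of
    the two linear equations. *)
Lemma tangent_vectorP p w : focal_variety J x0 p ->
  tangent_vector (focal_variety J x0) p w <->
  dot (p.1.1 - x0.1.1) w.1.1 + 2 * w.2 = 0 /\
  w.1.2 + 2^-1 *: vbracket J w.1.1 x0.1.1 = 0.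
Proof.
move=> Fp; split=> [[c [c0 dc Fc]]|].
  have dU := is_derive_Upsilon (is_derive_fst (is_derive_fst dc)).
  have UE : \forall y \near (0 : R), Upsilon J x0 (c y).1.1 = c y.
    by near=> y; apply/esym; have /focal_varietyP[] : focal_variety J x0 (c y)
      by near: y.
  have [_ dU'] := near_eq_is_derive UE dU.
  case: dc => _; rewrite dU' c0 => <- /=; split; first by field.
  by rewrite addNr.
case: w => [[wV wZ] wt] /= [h g].
exists (fun y => Upsilon J x0 (p.1.1 + y *: wV)).
have dl : is_derive (0 : R) 1 (fun y : R => p.1.1 + y *: wV) wV.
  apply: is_derive_eq (is_deriveD (is_derive_cst p.1.1 (0 : R) 1)
    (is_derive_scale (is_derive_id (0 : R) 1) (is_derive_cst wV (0 : R) 1))) _.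
  by rewrite scaler0 !add0r scale1r.
have dU := is_derive_Upsilon dl.
split.
- by rewrite scale0r addr0; case/focal_varietyP: Fp.
- apply: is_derive_eq dU _; rewrite scale0r addr0; congr (_, _, _).
    by apply/eqP; rewrite eq_sym -addr_eq0 g.
  by lra.
have /UpsilonP Up : focal_variety J x0 (Upsilon J x0 (p.1.1 + 0 *: wV)).
  by rewrite scale0r addr0; case/focal_varietyP: (Fp) => _ <-.
have Uc : {for (0 : R),
    continuous (fun y : R => (Upsilon J x0 (p.1.1 + y *: wV)).2)}.
  apply: differentiable_continuous; apply/derivable1_diffP.
  by have [] := is_derive_snd dU.
near=> y; apply/UpsilonP; near: y.
exact: (cvgr_gt _ Uc).
Unshelve. all: by end_near. Qed.

End FocalVariety.

(** * Geodesics with s = 0 at time 0, in closed form *)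

Section ExplicitGeodesic.
Variables (R : realType) (n m : nat) (J : {linear 'rV[R]_m -> 'End('rV[R]_n)}).
Hypothesis hJ : orthogonal_clifford_rep J.
Variables (p : dr_space R n m) (v : 'rV[R]_n) (z : 'rV[R]_m).
Hypothesis p_gt0 : 0 < p.2.
Hypothesis unit_vz : dot v v + dot z z = 1.

(* Up to left translation by p the curve is the one with coordinates
   2 T v / X + 2 T^2 J_z v / X, 2 T z / X, (1 - T^2) / X, where X = 1 + k T^2 and
   T is the hyperbolic tangent of x / 2; with hyperbolic functions of x itself
   the denominator X becomes D. *)
Let k := dot z z.
Let w := J z v.
Let ch (x : R) := (expR x + (expR x)^-1) / 2.
Let sh (x : R) := (expR x - (expR x)^-1) / 2.
Let D x := (1 + k) / 2 * ch x + (1 - k) / 2.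
Let N x := (1 - k) / 2 * ch x + (1 + k) / 2.
Let rD x := (Num.sqrt (D x))^-1.

Let is_derive_ch (x : R) : is_derive x 1 ch (sh x).
Proof.
have e0 : expR x != 0 by rewrite gt_eqF ?expR_gt0.
apply: is_derive_eq (is_derive_mul (is_derive_add (is_derive_expR x)
  (is_derive_inv e0 (is_derive_expR x))) (is_derive_const 2^-1 x)) _.
by rewrite /sh; field.
Qed.

Let is_derive_sh (x : R) : is_derive x 1 sh (ch x).
Proof.
have e0 : expR x != 0 by rewrite gt_eqF ?expR_gt0.
apply: is_derive_eq (is_derive_mul (is_derive_add (is_derive_expR x)
  (is_deriveN (is_derive_inv e0 (is_derive_expR x)))) (is_derive_const 2^-1 x)) _.
by rewrite /ch; field.
Qed.

Let is_derive_D (x : R) : is_derive x 1 D ((1 + k) / 2 * sh x).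
Proof.
apply: is_derive_eq (is_derive_add (is_derive_mul (is_derive_const _ x)
  (is_derive_ch x)) (is_derive_const _ x)) _.
by rewrite mul0r add0r addr0.
Qed.

Let is_derive_N (x : R) : is_derive x 1 N ((1 - k) / 2 * sh x).
Proof.
apply: is_derive_eq (is_derive_add (is_derive_mul (is_derive_const _ x)
  (is_derive_ch x)) (is_derive_const _ x)) _.
by rewrite mul0r add0r addr0.
Qed.

Let ch_sqr x : ch x * ch x = 1 + sh x * sh x.
Proof.
have e0 : expR x != 0 by rewrite gt_eqF ?expR_gt0.
by rewrite /ch /sh; field.
Qed.

Let vv : dot v v = 1 - k.
Proof. by rewrite -unit_vz addrK. Qed.

Let D_gt0 x : 0 < D x.
Proof.
have k0 : 0 <= k := dot_ge0 z.
have k1 : 0 <= 1 - k by rewrite -vv dot_ge0.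
have ch0 : 0 < ch x by rewrite /ch divr_gt0 // addr_gt0 ?invr_gt0 ?expR_gt0.
apply: ltr_wpDr; first exact: divr_ge0.
by apply: mulr_gt0 => //; rewrite divr_gt0 // ltr_wpDr.
Qed.

Let D_neq0 x : D x != 0.
Proof. by rewrite gt_eqF. Qed.

Let rD_sqr x : rD x * rD x = (D x)^-1.
Proof. by rewrite /rD -invfM -expr2 sqr_sqrtr // ltW. Qed.

Let is_derive_rD (x : R) :
  is_derive x 1 rD (- ((1 + k) / 2 * sh x / D x / 2) * rD x).
Proof.
have rD0 : Num.sqrt (D x) != 0 by rewrite gt_eqF // sqrtr_gt0.
apply: is_derive_eq (is_derive_inv _
  (is_derive_sqrt (D_gt0 x) (is_derive_D x))) _.
  exact: rD0.
rewrite /rD -{3}(sqr_sqrtr (ltW (D_gt0 x))).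
by field.
Qed.

Let is_derive_P (x : R) : is_derive x 1 (fun y => sh y / D y) (N x / D x / D x).
Proof.
apply: is_derive_eq (is_derive_mul (is_derive_sh x)
  (is_derive_inv (D_neq0 x) (is_derive_D x))) _.
have -> : N x = ch x * D x - sh x * ((1 + k) / 2 * sh x).
  rewrite (_ : _ - _ = (1 + k) / 2 * (ch x * ch x - sh x * sh x)
    + (1 - k) / 2 * ch x); last by rewrite /D; ring.
  by rewrite ch_sqr /N; ring.
by field.
Qed.

Let is_derive_Q (x : R) :
  is_derive x 1 (fun y => (ch y - 1) / D y) (sh x / D x / D x).
Proof.
have dch : is_derive x 1 (fun y => ch y + - 1) (sh x).
  apply: is_derive_eq (is_derive_add (is_derive_ch x) (is_derive_const _ x)) _.
  by rewrite addr0.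
apply: is_derive_eq (is_derive_mul dch
  (is_derive_inv (D_neq0 x) (is_derive_D x))) _.
have DE : D x - (ch x - 1) * ((1 + k) / 2) = 1 by rewrite /D; field.
transitivity (sh x / D x / D x * (D x - (ch x - 1) * ((1 + k) / 2))).
  by field.
by rewrite DE mulr1.
Qed.

Let is_derive_ND (x : R) :
  is_derive x 1 (fun y => N y / D y) (- k * sh x / D x / D x).
Proof.
apply: is_derive_eq (is_derive_mul (is_derive_N x)
  (is_derive_inv (D_neq0 x) (is_derive_D x))) _.
have kE : (1 + k) / 2 * N x - (1 - k) / 2 * D x = k by rewrite /D /N; field.
transitivity (- ((1 + k) / 2 * N x - (1 - k) / 2 * D x) * sh x / D x / D x).
  by field.
by rewrite kE.
Qed.

Let curve x : dr_space R n m :=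
  (p.1.1 + Num.sqrt p.2 *: ((sh x / D x) *: v + ((ch x - 1) / D x) *: w),
   p.1.2 + (p.2 * (sh x / D x)) *: z
   + (2^-1 * Num.sqrt p.2) *:
       vbracket J p.1.1 ((sh x / D x) *: v + ((ch x - 1) / D x) *: w),
   p.2 / D x).

Let velocity x : dr_space R n m :=
  (rD x *: ((N x / D x) *: v + (sh x / D x) *: w), (D x)^-1 *: z,
   - ((1 + k) / 2 * sh x / D x)).

Let is_derive_curve (x : R) :
  is_derive x 1 curve (left_field J (velocity x) (curve x)).
Proof.
have dPQ : is_derive x 1
    (fun y => (sh y / D y) *: v + ((ch y - 1) / D y) *: w)
    ((N x / D x / D x) *: v + (sh x / D x / D x) *: w).
  apply: is_derive_eq (is_deriveD
    (is_derive_scale (is_derive_P x) (is_derive_cst v _ _))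
    (is_derive_scale (is_derive_Q x) (is_derive_cst w _ _))) _.
  by rewrite !scaler0 !add0r.
have sqrtE : Num.sqrt (p.2 / D x) = Num.sqrt p.2 * rD x.
  by rewrite sqrtrM ?ltW // sqrtrV ?ltW.
have dV := is_deriveD (is_derive_cst p.1.1 x 1) (is_deriveZ (Num.sqrt p.2) dPQ).
have dZ := is_deriveD (is_deriveD (is_derive_cst p.1.2 x 1) (is_derive_scale
    (is_derive_mul (is_derive_const p.2 x) (is_derive_P x))
    (is_derive_cst z x 1)))
  (is_deriveZ (2^-1 * Num.sqrt p.2)
    (is_derive_vbracket J (is_derive_cst p.1.1 x 1) dPQ)).
have dt := is_derive_mul (is_derive_const p.2 x)
  (is_derive_inv (D_neq0 x) (is_derive_D x)).
apply: is_derive_eq (is_derive_pair (is_derive_pair dV dZ) dt) _.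
rewrite left_fieldE /curve /velocity /= sqrtE; congr (_, _, _).
- rewrite add0r scalerA -(mulrA (Num.sqrt p.2)) rD_sqr !scalerDr !scalerA.
  by congr (_ *: _ + _ *: _); field.
- apply: dot_ext => Z; rewrite !(dotDl, dotZl) !dot_vbracket.
  rewrite !linear0 !(linearD, linearZ) /= !dotE.
  rewrite (clif_skew hJ Z w v) (dotC w) /w (dot_clif_center hJ) -/w.
  rewrite !(dot_clif_self hJ) vv (dotC Z) -(rD_sqr x).
  set q := Num.sqrt p.2; have -> : p.2 = q * q.
    by rewrite -expr2 sqr_sqrtr // ltW.
  (* What is left of the equation after cancelling the terms linear in [p, .]. *)
  have E : N x - 1 - 2^-1 * (1 - k) * (rD x * rD x)
      * (sh x * sh x - (ch x - 1) * N x) = 0.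
    have -> : sh x * sh x - (ch x - 1) * N x = (ch x - 1) * D x.
      transitivity (ch x * ch x - 1 - (ch x - 1) * N x).
        by rewrite ch_sqr; ring.
      by rewrite /N /D; field.
    rewrite rD_sqr; transitivity (N x - 1 - 2^-1 * (1 - k) * (ch x - 1)).
      by field.
    by rewrite /N; field.
  apply/eqP; rewrite -subr_eq0; apply/eqP.
  transitivity (q * q * (rD x * rD x * (rD x * rD x)) * dot z Z *
      (N x - 1 - 2^-1 * (1 - k) * (rD x * rD x)
        * (sh x * sh x - (ch x - 1) * N x))); last by rewrite E mulr0.
  by field.
- by field.
Qed.

Let is_derive_velocity (x : R) :
  is_derive x 1 velocity (geodesic_field J (velocity x)).
Proof.
have dv := is_derive_scale (is_derive_rD x) (is_deriveD
  (is_derive_scale (is_derive_ND x) (is_derive_cst v x 1))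
  (is_derive_scale (is_derive_P x) (is_derive_cst w x 1))).
have dz := is_derive_scale (is_derive_inv (D_neq0 x) (is_derive_D x))
  (is_derive_cst z x 1).
have ds := is_deriveN (is_derive_mul (is_derive_mul
    (is_derive_const ((1 + k) / 2) x) (is_derive_sh x))
  (is_derive_inv (D_neq0 x) (is_derive_D x))).
apply: is_derive_eq (is_derive_pair (is_derive_pair dv dz) ds) _.
rewrite /geodesic_field /velocity /=; congr (_, _, _).
- have -> : J ((D x)^-1 *: z) (rD x *: ((N x / D x) *: v + (sh x / D x) *: w)) =
      (D x)^-1 *: (rD x *: ((N x / D x) *: w - (sh x / D x * k) *: v)).
    rewrite clifZl !(linearD, linearZ) /= /w (clif_sqr hJ) -/w -/k.
    by apply: dot_ext => Z; rewrite !dotE; field.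
  by apply: dot_ext => Z; rewrite !dotE; field.
- by rewrite scaler0 add0r scalerA; congr (_ *: _); field.
- rewrite !(dotDl, dotDr, dotZl, dotZr) (dotC v w) (dot_clif_self hJ).
  rewrite (dot_clif hJ) vv -/k.
  have NN : (N x * N x + k * (sh x * sh x)) / (D x * D x) = 1.
    have -> : N x * N x + k * (sh x * sh x) = D x * D x.
      transitivity (N x * N x + k * (ch x * ch x - 1)).
        by rewrite ch_sqr; ring.
      by rewrite /N /D; field.
    by rewrite mulfV // mulf_neq0.
  have DD : (1 + k) / 2 * (ch x * D x - (1 + k) / 2 * (sh x * sh x)) =
      (1 - k) / 2 * D x + k.
    transitivity ((1 + k) / 2 * (ch x * D x - (1 + k) / 2 * (ch x * ch x - 1))).
      by rewrite ch_sqr; ring.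
    by rewrite /D; field.
  transitivity (- ((1 + k) / 2 * (ch x * D x - (1 + k) / 2 * (sh x * sh x))
      / (D x * D x))).
    by field.
  rewrite DD.
  transitivity (- ((rD x * rD x) * (1 - k) / 2
    * ((N x * N x + k * (sh x * sh x)) / (D x * D x)) + k / (D x * D x))).
    by rewrite NN rD_sqr; field.
  by field.
Qed.

(** Unit speed and s = 0 at time 0 suffice: both tangency and the vanishing of the
    second derivative are homogeneous in the velocity, and the velocities used in
    [J2_of_geodesics] have s = 0. *)
Lemma exists_geodesic : exists c omega : R -> dr_space R n m,
  [/\ c 0 = p, omega 0 = (v, z, 0), forall x, 0 < (c x).2,
     forall x : R, is_derive x 1 c (left_field J (omega x) (c x))
   & forall x : R, is_derive x 1 omega (geodesic_field J (omega x))].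
Proof.
have ch0 : ch 0 = 1 by rewrite /ch expR0 invr1; field.
have sh0 : sh 0 = 0 by rewrite /sh expR0 invr1; field.
have D0 : D 0 = 1 by rewrite /D ch0; field.
have N0 : N 0 = 1 by rewrite /N ch0; field.
exists curve, velocity; split=> //.
- rewrite /curve ch0 sh0 D0 subrr !(mul0r, mulr0, scale0r, addr0).
  by rewrite linear0r !(scaler0, addr0) divr1; case: p => [[]].
- rewrite /velocity sh0 D0 N0 /rD D0 sqrtr1 invr1 mulr0 !mul0r scale0r.
  by rewrite !(mulr1, scale1r, addr0, oppr0).
- by move=> x; rewrite /curve /= divr_gt0.
Qed.

End ExplicitGeodesic.

(** * The J^2-condition as vanishing of the second derivative *)

Section J2Algebra.
Variables (R : realType) (n m : nat) (J : {linear 'rV[R]_m -> 'End('rV[R]_n)}).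
Hypothesis hJ : orthogonal_clifford_rep J.

(** Split Z into its component along z, where the first hypothesis applies, and a
    component Z1 orthogonal to z, where the J^2-condition moves J_z J_Z1 w back
    into the vectors J_Z3 w, to which the second hypothesis applies. *)
Lemma J2_second_derivative (w v : 'rV[R]_n) (z : 'rV[R]_m) (s r : R) :
  J2_condition J w -> r * dot w v + 2 * s = 0 ->
  (forall Z, dot z Z + 2^-1 * (r * dot (J Z w) v) = 0) ->
  forall Z, s * dot z Z + 2^-1 * (r * dot (J Z w) (J z v)) = 0.
Proof.
move=> hw h0 k0 Z.
have [->|z0] := eqVneq z 0; first by rewrite clif0l !dotE !mulr0 addr0.
have zz : dot z z != 0 by rewrite dot_eq0.
pose a := dot z Z / dot z z; pose Z1 := Z - a *: z.
have zZ1 : dot z Z1 = 0 by rewrite /Z1 !dotE /a; field.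
have [Z3 Z3E] := hw _ _ zZ1.
have -> : Z = a *: z + Z1 by rewrite addrC subrK.
clearbody Z1; rewrite clifDl clifZl !dotE zZ1 (dot_clif_vec hJ).
have -> : r * (a * (dot z z * dot w v) + dot (J Z1 w) (J z v)) =
    a * dot z z * (r * dot w v) - r * dot (J Z3 w) v.
  by rewrite -Z3E (clif_skew hJ z); ring.
have zZ3 : dot z Z3 * dot w w = 0.
  by rewrite -(dot_clif_center hJ) -Z3E (dot_clif_vec hJ) dotC
    (dot_clif_self hJ) mulr0.
have -> : r * dot (J Z3 w) v = 0.
  have /eqP := zZ3; rewrite mulf_eq0 dot_eq0 => /orP[/eqP zZ3'|/eqP->].
    by have := k0 Z3; rewrite zZ3'; lra.
  by rewrite linear0 dot0l mulr0.

transitivity (2^-1 * (a * dot z z) * (r * dot w v + 2 * s)); first by field.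
by rewrite h0 mulr0.
Qed.

(** The vectors J_Z w are an isometric copy of z up to the factor |w|, so z3 below
    gives the orthogonal projection of x = J_z1 J_z2 w onto them.  Testing the
    hypothesis on J_z1 w + y, with y the remainder, shows that y is orthogonal to
    x and hence to itself. *)
Lemma J2_of_orthogonal (w : 'rV[R]_n) :
  (forall v Z, dot w v = 0 -> dot (J Z w) (J (vbracket J w v) v) = 0) ->
  J2_condition J w.
Proof.
move=> H z1 z2 z12; have [->|w0] := eqVneq w 0.
  by exists 0; rewrite !linear0.
have ww : dot w w != 0 by rewrite dot_eq0.
pose x := J z1 (J z2 w); pose z3 := (dot w w)^-1 *: vbracket J w x.
pose y := x - J z3 w; exists z3; rewrite -/x.
have yperp Z : dot (J Z w) y = 0.
  rewrite dotBr (dot_clif_center hJ) dotZr (dotC Z) dot_vbracket; field.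
  exact: ww.
have wx : dot w x = 0.
  have := clif_skew hJ z1 w (J z2 w); rewrite (dot_clif_center hJ) z12 -/x; lra.
have wJ Z : dot w (J Z w) = 0 by rewrite dotC (dot_clif_self hJ).
have wv : dot w (J z1 w + y) = 0 by rewrite dotDr dotBr !wJ wx; ring.
have brE : vbracket J w (J z1 w + y) = dot w w *: z1.
  apply: dot_ext => Z; rewrite dot_vbracket dotDr yperp (dot_clif_center hJ).
  by rewrite dotZl (dotC z1); ring.
have xv : dot x (J z1 w + y) = 0.
  have := H _ z2 wv; rewrite brE clifZl dotZr => /eqP.
  rewrite mulf_eq0 (negbTE ww) /= => /eqP.
  by rewrite /x (clif_skew hJ z1) => ->; rewrite oppr0.
have xw : dot x (J z1 w) = 0.
  by rewrite /x (dot_clif_vec hJ) (dot_clif_self hJ) mulr0.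
apply/eqP; rewrite -subr_eq0 -/y -dot_eq0 {1}/y dotBl yperp subr0.
by move: xv; rewrite dotDr xw add0r => ->.
Qed.

End J2Algebra.

(** * Totally geodesic points of the focal variety *)

Section FocalGeodesics.
Variables (R : realType) (n m : nat) (J : {linear 'rV[R]_m -> 'End('rV[R]_n)}).
Hypothesis hJ : orthogonal_clifford_rep J.
Variable x0 : dr_space R n m.
Implicit Types (p X : dr_space R n m) (V : 'rV[R]_n).

Lemma focal_variety_dotP p : focal_variety J x0 p <->
  [/\ 0 < p.2, dot (p.1.1 - x0.1.1) (p.1.1 - x0.1.1) + 4 * (p.2 + x0.2) = 0
    & forall Z, dot (p.1.2 - x0.1.2 + 2^-1 *: vbracket J p.1.1 x0.1.1) Z = 0].
Proof.
rewrite focal_varietyP; split=> [[p0 pE]|[p0 hE gE]]; split=> //.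
- by rewrite {3}pE /Upsilon /= enorm_sqr; field.
- move=> Z; rewrite {1}pE /Upsilon /=.
  by rewrite (addrAC x0.1.2) subrr add0r addNr dot0l.
case: p p0 hE gE => [[V Z] t] /= p0 hE gE; rewrite /Upsilon /=.
congr (_, _, _); last by rewrite enorm_sqr; lra.
apply/eqP; rewrite -subr_eq0 opprB addrA addrAC; apply/eqP.
by apply: dot_ext => Y; rewrite gE dot0l.
Qed.

Lemma vbracket_skew (u v : 'rV[R]_n) : vbracket J u v = - vbracket J v u.
Proof.
apply: dot_ext => Z; rewrite dotNl !dot_vbracket.
by rewrite (clif_skew hJ) dotC.
Qed.

(** In the left-invariant frame the tangency equations read h = 0 and k = 0. *)
Lemma tangent_left_fieldP p X : focal_variety J x0 p ->
  tangent_vector (focal_variety J x0) p (left_field J X p) <->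
  (Num.sqrt p.2)^-1 * dot (p.1.1 - x0.1.1) X.1.1 + 2 * X.2 = 0 /\
  (forall Z, dot X.1.2 Z
    + 2^-1 * ((Num.sqrt p.2)^-1 * dot (J Z (p.1.1 - x0.1.1)) X.1.1) = 0).
Proof.
move=> Fp; rewrite (tangent_vectorP _ Fp) left_fieldE /=.
have p0 : 0 < p.2 by case: Fp.
set q := Num.sqrt p.2; have q0 : q != 0 by rewrite gt_eqF // sqrtr_gt0.
have -> : p.2 = q * q by rewrite -expr2 sqr_sqrtr // ltW.
have hE : dot (p.1.1 - x0.1.1) (q *: X.1.1) + 2 * (q * q * X.2) =
    q * q * (q^-1 * dot (p.1.1 - x0.1.1) X.1.1 + 2 * X.2).
  by rewrite dotZr; field.
have gE Z : dot (q * q *: X.1.2 + (2^-1 * q) *: vbracket J p.1.1 X.1.1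
      + 2^-1 *: vbracket J (q *: X.1.1) x0.1.1) Z =
    q * q * (dot X.1.2 Z
      + 2^-1 * (q^-1 * dot (J Z (p.1.1 - x0.1.1)) X.1.1)).
  rewrite (vbracket_skew _ x0.1.1) linearB !dotE !dot_vbracket !dotE.
  by field.
have qq : q * q != 0 by rewrite mulf_neq0.
split=> -[h g]; split.
- by apply/eqP; move/eqP: h; rewrite hE mulf_eq0 (negbTE qq).
- move=> Z; apply/eqP; have /eqP := gE Z.
  by rewrite g dot0l eq_sym mulf_eq0 (negbTE qq).
- by rewrite hE h mulr0.
- by apply: dot_ext => Z; rewrite gE g mulr0 dot0l.
Qed.

Lemma geodesic_in_focal_variety (c : R -> dr_space R n m) :
   J2_condition J ((c 0).1.1 - x0.1.1) ->
  geodesic J c -> focal_variety J x0 (c 0) ->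
  tangent_vector (focal_variety J x0) (c 0) (derive1 c 0) ->
  forall x : R, focal_variety J x0 (c x).
Proof.
move=> hw /(geodesicP hJ)[ct [omega ho]].
have dc (x : R) : is_derive x 1 c (left_field J (omega x) (c x)) by case: (ho x).
have dom (x : R) : is_derive x 1 omega (geodesic_field J (omega x)).
  by case: (ho x).
move=> Fc0; have -> : derive1 c 0 = left_field J (omega 0) (c 0).
  by rewrite derive1E; case: (dc 0).
move=> /(tangent_left_fieldP _ Fc0)[h0 k0].
have /focal_variety_dotP[_ f0 g0] := Fc0.
have l0 := J2_second_derivative hJ hw h0 k0.
have kx Z (x : R) : focal_center' J c omega x0 Z x = 0.
  by apply: (focal_center'_eq0 hJ ct dc dom) => //; [exact: k0|exact: l0].
have hx (x : R) : focal_height' c omega x0 x = 0.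
  rewrite -h0; apply: is_derive_0_is_cst => y.
  apply: is_derive_eq (is_derive_focal_height' hJ ct dc dom x0 y) _.
  have := kx (omega y).1.2 y; rewrite /focal_center'.
  by move=> ?; lra.
move=> x; apply/focal_variety_dotP; split=> // [|Z].
  have fx : focal_height c x0 x = focal_height c x0 0.
    apply: is_derive_0_is_cst => y.
    apply: is_derive_eq (is_derive_focal_height ct dc x0 y) _.
    by rewrite hx mulr0.
  exact: etrans fx f0.
by apply: (focal_center_eq0 hJ ct dc dom); [exact: g0|exact: k0|exact: l0].
Qed.

(** For a tangent velocity with <w, v> = 0 the s-component is 0 and z is determined
    by v.  After normalization the explicit geodesic applies, and l = 0 at time 0
    is the orthogonality required by [J2_of_orthogonal]. *)
Lemma J2_of_geodesics p : focal_variety J x0 p ->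
  (forall c : R -> dr_space R n m, geodesic J c -> c 0 = p ->
    tangent_vector (focal_variety J x0) p (derive1 c 0) ->
    forall x : R, focal_variety J x0 (c x)) ->
  J2_condition J (p.1.1 - x0.1.1).
Proof.
move=> Fp H; apply: (J2_of_orthogonal hJ) => v Z wv.
set w := p.1.1 - x0.1.1 in wv *.
have p0 : 0 < p.2 by case: Fp.
have r0 : (Num.sqrt p.2)^-1 != 0 by rewrite invr_eq0 gt_eqF // sqrtr_gt0.
pose r := (Num.sqrt p.2)^-1.
have [->|v0] := eqVneq v 0; first by rewrite !linear0 dot0r.
(* k = 0 forces this value of z; it is kept behind an equation so that linearity
   rewrites do not expand it. *)
have [z zE] : exists z, z = - (2^-1 * r) *: vbracket J w v by eexists.
pose e := dot v v + dot z z.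
have e0 : 0 < e.
  by rewrite /e ltr_pwDl ?dot_ge0 // lt_def dot_eq0 v0 dot_ge0.
pose l := (Num.sqrt e)^-1.
have l0 : l != 0 by rewrite invr_eq0 gt_eqF // sqrtr_gt0.
have unit_vz : dot (l *: v) (l *: v) + dot (l *: z) (l *: z) = 1.
  rewrite !(dotZl, dotZr) !mulrA -mulrDr -/e /l -invfM -expr2.
  by rewrite sqr_sqrtr ?mulVf ?gt_eqF // ltW.
have [c [omega [c0 om0 ct dc dom]]] := exists_geodesic hJ p0 unit_vz.
have k0 Y : dot (l *: z) Y + 2^-1 * (r * dot (J Y w) (l *: v)) = 0.
  by rewrite zE !dotE dot_vbracket; ring.
have Fc : forall x, focal_variety J x0 (c x).
  apply: H => //; first by apply/(geodesicP hJ); split=> //; exists omega.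
  rewrite derive1E; have [_ ->] := dc 0; rewrite c0 om0.
  apply/tangent_left_fieldP => //=; split=> [|Y]; last exact: k0.
  by rewrite dotZr wv !mulr0 addr0.
have g0 (x : R) : focal_center J c x0 Z x = 0.
  by have /focal_variety_dotP[_ _ gx] := Fc x; exact: gx.
have := focal_center''_0 hJ ct dc dom g0.
rewrite /focal_center'' c0 om0 /= mul0r add0r -/w -/r clifZl.
rewrite zE linearZ /= clifZl !dotZr => /eqP.
(* The remaining equation is the wanted one times - l^2 r^2 / 4. *)
rewrite !mulf_eq0 (negbTE l0) invr_eq0 pnatr_eq0 (negbTE r0) /= oppr_eq0.
by rewrite mulf_eq0 invr_eq0 pnatr_eq0 (negbTE r0) /= => /eqP.
Qed.

Lemma open_ballP V (t : R) : 0 < t ->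
  open_ball x0.1.1 (2 * Num.sqrt t) V <-> enorm (V - x0.1.1) ^+ 2 < 4 * t.
Proof.
move=> t0; have -> : 4 * t = (2 * Num.sqrt t) ^+ 2.
  by rewrite exprMn sqr_sqrtr ?ltW //; ring.
by rewrite ltr_pXn2r // nnegrE ?enorm_ge0 // mulr_ge0 // sqrtr_ge0.
Qed.

Lemma ball_Upsilon V : x0.2 < 0 ->
  open_ball x0.1.1 (2 * Num.sqrt (- x0.2)) V <->
  focal_variety J x0 (Upsilon J x0 V).
Proof.
move=> t0; rewrite UpsilonP open_ballP ?oppr_gt0 //=.
by split=> ?; lra.
Qed.

Lemma is_diff_Upsilon V : is_diff V (Upsilon J x0)
  (fun h => (h, - (2^-1 *: vbracket J h x0.1.1),
             - (2^-1 * dot (V - x0.1.1) h))).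
Proof.
have dU : is_diff V (fun y => y - x0.1.1) id.
  apply: is_diff_eq (is_diffB (is_diff_id V) (is_diff_cst x0.1.1 V)) _.
  by apply/funext => h; rewrite /= subr0.
have dB := is_diff_bilinear (@continuous_rV_bilinear _ _ _ _ (vbracket J))
  (is_diff_id V) (is_diff_cst x0.1.1 V).
have dD := is_diff_bilinear (@continuous_rV_bilinear _ _ _ _ (@dot R n)) dU dU.
have dZ := is_diffB (is_diff_cst x0.1.2 V) (is_diffZ 2^-1 dB).
have dt := is_diffB (is_diff_cst (- x0.2) V) (is_diffZ 4^-1 dD).
have -> : Upsilon J x0 = (fun y => (id y,
    x0.1.2 - 2^-1 *: vbracket J y x0.1.1,
    - x0.2 - 4^-1 *: dot (y - x0.1.1) (y - x0.1.1))).
  by apply/funext => y; rewrite /Upsilon enorm_sqr.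
apply: is_diff_eq (is_diff_pair (is_diff_pair (is_diff_id V) dZ) dt) _.
apply/funext => h /=; congr (_, _, _).
  by rewrite !fctE /= linear0r !add0r.
rewrite !fctE /= (dotC h).
by rewrite -[X in - X]/(4^-1 * _) sub0r; field.
Qed.

End FocalGeodesics.

Theorem theorem10p2 (R : realType) (n m : nat)
    (J : {linear 'rV[R]_m -> 'End('rV[R]_n)})
    (hJ : orthogonal_clifford_rep J)
    (V0 : 'rV[R]_n) (Z0 : 'rV[R]_m) (t0 : R) (ht0 : t0 < 0) :
  let x0 : dr_space R n m := (V0, Z0, t0) in
  let B := open_ball V0 (2 * Num.sqrt (- t0)) in
  let F := focal_variety J x0 in
  [/\ set_bij B F (Upsilon J x0),
      forall V : 'rV[R]_n, B V ->
        differentiable (Upsilon J x0) V /\ injective ('d (Upsilon J x0) V)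
    & forall V : 'rV[R]_n, B V ->
        ((forall c : R -> dr_space R n m,
            geodesic J c -> c 0 = Upsilon J x0 V ->
            tangent_vector F (Upsilon J x0 V) (derive1 c 0) ->
            forall x : R, F (c x))
         <-> J2_condition J (V - V0))].
Proof.
move=> x0 B F.
have BF V : B V <-> F (Upsilon J x0 V) by exact: (@ball_Upsilon _ _ _ J x0 V ht0).
split.
- split; first by move=> V /BF.
    by move=> V V' _ _ [].
  move=> p Fp; exists p.1.1; last by case/focal_varietyP: Fp => _ <-.
  by apply/BF; case/focal_varietyP: (Fp) => _ <-.
- move=> V _; have [dU dUE] := is_diff_Upsilon J x0 V; split=> // h1 h2.
  by rewrite dUE => -[].
move=> V /BF FV; split=> [stay|hV c gc c0 tc].
  exact: J2_of_geodesics stay.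
rewrite -c0 in FV tc.
by apply: geodesic_in_focal_variety => //; rewrite c0.
Qed.
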